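(* If a metric space satisfies the $\boxtimes$-inequalities, then it is a $\mathrm{Cycl}_n(0)$ space for every integer $n\geq 4$.
   Context: Definition. A metric space $(X,d_X)$ satisfies the $\boxtimes$-inequalities if for any $t,s\in[0,1]$ and any $x,y,z,w\in X$, $$0\leq (1-t)(1-s)d_X(x,y)^2+t(1-s)d_X(y,z)^2+ts\,d_X(z,w)^2+(1-t)s\,d_X(w,x)^2-t(1-t)d_X(x,z)^2-s(1-s)d_X(y,w)^2.$$ Definition. For an integer $n\geq 4$, a metric space $(X,d_X)$ is a $\mathrm{Cycl}_n(0)$ space if for any map $f:\mathbb{Z}/n\mathbb{Z}\to X$ there exists a map $g:\mathbb{Z}/n\mathbb{Z}\to\mathbb{R}^2$ such that $\|g(i)-g(i+[1]_n)\|\leq d_X(f(i),f(i+[1]_n))$ for every $i$, and $\|g(i)-g(j)\|\geq d_X(f(i),f(j))$ for any $i,j$ with $j\neq i+[1]_n$ and $i\neq j+[1]_n$. Here $[m]_n$ denotes the class of the integer $m$ in $\mathbb{Z}/n\mathbb{Z}$ and $\|\cdot\|$ is the Euclidean norm. *)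

(* Defs.v *)
From mathcomp Require Import all_boot all_order all_algebra.
From mathcomp Require Import reals topology.

Set Implicit Arguments.
Unset Strict Implicit.
Unset Printing Implicit Defensive.

Import Order.TTheory GRing.Theory Num.Theory.
Local Open Scope ring_scope.

(* The norm that the library puts on 'rV[R]_n is the sup norm, hence the
   explicit Euclidean one. *)
Definition euclidean_norm (R : realType) (n : nat) (v : 'rV[R]_n) : R :=
  Num.sqrt (\sum_(k < n) v 0 k ^+ 2).

Definition boxtimes_inequalities (R : realType) (X : metricType R) : Prop :=
  forall (t s : R) (x y z w : X), 0 <= t <= 1 -> 0 <= s <= 1 ->
    0 <= (1 - t) * (1 - s) * mdist x y ^+ 2 + t * (1 - s) * mdist y z ^+ 2
         + t * s * mdist z w ^+ 2 + (1 - t) * s * mdist w x ^+ 2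
         - t * (1 - t) * mdist x z ^+ 2 - s * (1 - s) * mdist y w ^+ 2.

(* Only meant for 4 <= n; 'Z_n is the ring of integers modulo n as soon as
   1 < n, and the 1 below is its unit, the class of the integer 1. *)
Definition Cycl0 (n : nat) (R : realType) (X : metricType R) : Prop :=
  forall f : 'Z_n -> X, exists g : 'Z_n -> 'rV[R]_2,
    (forall i : 'Z_n,
       euclidean_norm (g i - g (i + 1)) <= mdist (f i) (f (i + 1))) /\
    (forall i j : 'Z_n, j <> i + 1 -> i <> j + 1 ->
       mdist (f i) (f j) <= euclidean_norm (g i - g j)).

(* Main.v *)
Require Import Defs.
From mathcomp Require Import all_boot all_order all_algebra.
From mathcomp Require Import reals topology.
From mathcomp Require Import boolp classical_sets normedtype derive.
From mathcomp Require Import ring lra zify.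

Set Implicit Arguments.
Unset Strict Implicit.
Unset Printing Implicit Defensive.

Import Order.TTheory GRing.Theory Num.Theory.
Import numFieldNormedType.Exports.
Local Open Scope ring_scope.

(** Let D be the squared distance on the n given points.  Among all closed
    n-gons g in the plane, minimize a penalty that punishes |g_i - g_(i+1)|^2
    for differing from D on the sides and, with a small positive weight delta
    on top, punishes every diagonal for being short.  The derivatives of the
    penalty form an equilibrium stress w at the minimum, negative on all
    diagonals.  If sum w D >= 0, then sum w (|g_i - g_j|^2 - D) <= 0 bounds the
    failure of g by a multiple of delta, and delta -> 0 gives the theorem.

    To see that sum w D >= 0, suppose first that g is not contained in a line.
    No reflection of an arc in a supporting line can decrease the penalty;
    together with the equilibrium this forces g to be a strictly convex
    polygon.  For such a g the quadrilateral inequalities yield an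
    infinitesimal motion of g whose rate of change is D on the sides and at
    least D on the diagonals, and the virtual work of w along this motion is
    zero.

    If g is contained in a line, then moving it out of the line shows that w is
    positive semidefinite.  Subtracting from w suitable multiples of forms that
    are nonnegative on D, one gets a semidefinite stress with a planar kernel
    configuration, to which the first case applies. *)

(** * Infinitesimal motions of convex polygons *)

(** Twice the signed area of the triangle [i j k], positive when it is traversed
    counterclockwise. *)
Definition orient (R : pzRingType) (T : Type) (x y : T -> R) (i j k : T) : R :=
  (x j - x i) * (y k - y i) - (x k - x i) * (y j - y i).

(* Homogeneous form of the boxtimes inequalities: t = c / (a + c) and
   s = e / (a + c). *)
Definition quad_ineq (R : numDomainType) (T : Type) (D : T -> T -> R) : Prop :=
  forall (i j k l : T) (a b c e : R),
    0 <= a -> 0 <= b -> 0 <= c -> 0 <= e -> a + c = b + e ->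
    a * c * D i k + b * e * D j l
      <= a * b * D i j + b * c * D j k + c * e * D k l + e * a * D l i.

(** Each step turns the ray from vertex [0] to the left, and the first hypothesis keeps all rays
    left of the one through vertex [1], so the turning never exceeds a half turn. *)
Lemma orient_fan (R : realFieldType) (x y : nat -> R) (m : nat) :
  (forall k, (1 < k <= m)%N -> 0 < orient x y 0 1 k) ->
  (forall k, (0 < k < m)%N -> 0 < orient x y 0 k k.+1) ->
  forall j k, (0 < j < k)%N -> (k <= m)%N -> 0 < orient x y 0 j k.
Proof.
move=> h1 hs j; elim=> [|k IH]; first by lia.
move=> jk km.
have [->|neq] := eqVneq k j; first by apply: hs; lia.
have jk' : (0 < j < k)%N by lia.
have A := IH jk' (ltnW km).
have B : 0 < orient x y 0 k k.+1 by apply: hs; lia.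
have [j1|j1] := eqVneq j 1%N; first by rewrite j1; apply: h1; lia.
have C1 : 0 < orient x y 0 1 j by apply: h1; lia.
have C2 : 0 < orient x y 0 1 k by apply: h1; lia.
have C3 : 0 < orient x y 0 1 k.+1 by apply: h1; lia.
(* Plücker relation *)
have P : orient x y 0 1 k * orient x y 0 j k.+1 =
   orient x y 0 1 j * orient x y 0 k k.+1
   + orient x y 0 1 k.+1 * orient x y 0 j k by rewrite /orient; ring.
by rewrite -(pmulr_rgt0 _ C2) P addr_gt0 ?mulr_gt0.
Qed.

(* The weights in [quad_ineq] are those of the affine relation between four
   points in convex position, and these annihilate every motion.  So a motion
   that is exact on two sides and one diagonal of a quadrilateral and fast
   enough on the other two sides is fast enough on the other diagonal. *)
Lemma convex_flex (R : realFieldType) (x y : nat -> R) (D : nat -> nat -> R) m :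
  (forall i j, D i j = D j i) -> quad_ineq D ->
  (0 < m)%N -> (x 0%N != x 1%N) || (y 0%N != y 1%N) ->
  (forall j k, (0 < j < k)%N -> (k <= m)%N -> 0 < orient x y 0 j k) ->
  (forall j k, (j < k < m)%N -> 0 < orient x y j k k.+1) ->
  exists u v : nat -> R, forall i j, (i < j <= m)%N ->
    let e := (x i - x j) * (u i - u j) + (y i - y j) * (v i - v j) in
    D i j <= e /\ ((j == i.+1) || (i == 0%N) && (j == m) -> D i j = e).
Proof.
move=> Ds Dq; case: m => // m _ p01; elim: m => [|m IH] hfan hside.
  (* For two points, vertex [0] alone moves, along the segment. *)
  pose q := (x 0%N - x 1%N) ^+ 2 + (y 0%N - y 1%N) ^+ 2.
  have q0 : q != 0.
    by rewrite paddr_eq0 ?sqr_ge0// !sqrf_eq0 !subr_eq0 negb_and.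
  exists (fun i => (i == 0%N)%:R * (D 0%N 1%N * (x 0%N - x 1%N) / q)).
  exists (fun i => (i == 0%N)%:R * (D 0%N 1%N * (y 0%N - y 1%N) / q)).
  move=> i j ij e.
  have [i0 j1] : i = 0%N /\ j = 1%N by lia.
  suff -> : D i j = e by [].
  by rewrite /e i0 j1 /= /q; field.
have [||u [v uv]] := IH.
- by move=> j k jk km; apply: hfan => //; lia.
- by move=> j k jk; apply: hside; lia.
(* The velocity [(U, V)] of the new vertex [M] is determined by exactness on its sides to [0] and
   [k], by Cramer's rule with determinant [dt]. *)
set M := m.+2; set k := m.+1.
pose ax := x M - x 0%N; pose ay := y M - y 0%N.
pose bx := x M - x k; pose by_ := y M - y k.
pose r0 := D 0%N M + ax * u 0%N + ay * v 0%N.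
pose rk := D k M + bx * u k + by_ * v k.
pose dt := ax * by_ - ay * bx.
have dtE : dt = orient x y 0 k M by rewrite /dt /ax /ay /bx /by_ /orient; ring.
have d0 : dt != 0 by rewrite dtE lt0r_neq0// hfan //; lia.
pose U := (r0 * by_ - rk * ay) / dt; pose V := (ax * rk - bx * r0) / dt.
have e0 : ax * (U - u 0%N) + ay * (V - v 0%N) = D 0%N M.
  rewrite /U /V /r0 /rk; move: d0; rewrite /dt => d0; field; exact: d0.
have ek : bx * (U - u k) + by_ * (V - v k) = D k M.
  rewrite /U /V /r0 /rk; move: d0; rewrite /dt => d0; field; exact: d0.
exists (fun i => if i == M then U else u i).
exists (fun i => if i == M then V else v i).
move=> i j ijM e.
have iM : (i == M) = false by apply/eqP; lia.
rewrite {}/e iM.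
have [jM|jM] := eqVneq j M; last first.
  have [|h1 h2] := uv i j; first by lia.
  split=> // h; apply: h2; move: h jM; rewrite /M; lia.
rewrite jM.
have [->|i0] := eqVneq i 0%N.
  suff -> : (x 0%N - x M) * (u 0%N - U) + (y 0%N - y M) * (v 0%N - V) = D 0%N M by [].
  by rewrite -e0 /ax /ay; ring.
have [->|ik] := eqVneq i k.
  suff -> : (x k - x M) * (u k - U) + (y k - y M) * (v k - V) = D k M by [].
  by rewrite -ek /bx /by_; ring.
split; last by move: ik; rewrite /k /M; lia.
have [|h0i _] := uv 0%N i; first by lia.
have [|hik _] := uv i k; first by lia.
(* [0 k] is the closing side of the smaller polygon, so the motion is exact on this diagonal of the
   quadrilateral [0 i k M]. *)
have [|_ h0k] := uv 0%N k; first by lia.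
have {}h0k : D 0%N k = (x 0%N - x k) * (u 0%N - u k) + (y 0%N - y k) * (v 0%N - v k).
  by apply: h0k; rewrite !eqxx orbT.
(* Each weight is the doubled area of the triangle left after dropping one vertex of [0 i k M];
   [a + c] and [b + d] both give the doubled area of the quadrilateral. *)
pose a := orient x y i k M; pose b := orient x y 0 k M.
pose c := orient x y 0 i M; pose d := orient x y 0 i k.
have a0 : 0 < a by apply: hside; lia.
have b0 : 0 < b by apply: hfan; lia.
have c0 : 0 < c by apply: hfan; lia.
have dd0 : 0 < d by apply: hfan; lia.
have abcd : a + c = b + d by rewrite /a /b /c /d /orient; ring.
have := Dq 0%N i k M _ _ _ _ (ltW a0) (ltW b0) (ltW c0) (ltW dd0) abcd.
rewrite [D M _]Ds h0k -e0 -ek => Q.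
set e0i := _ + _ in h0i; set eik := _ + _ in hik.
have H1 := ler_wpM2l (ltW (mulr_gt0 a0 b0)) h0i.
have H2 := ler_wpM2l (ltW (mulr_gt0 b0 c0)) hik.
rewrite -(ler_pM2l (mulr_gt0 b0 dd0)).
set lhs := b * d * D i M in Q *; set rhs := (X in _ <= X).
have I : a * c * ((x 0%N - x k) * (u 0%N - u k) + (y 0%N - y k) * (v 0%N - v k)) + rhs
  = a * b * e0i + b * c * eik + c * d * (bx * (U - u k) + by_ * (V - v k))
   + d * a * (ax * (U - u 0%N) + ay * (V - v 0%N)).
  rewrite /rhs /e0i /eik /bx /by_ /ax /ay /a /b /c /d /orient; ring.
lra.
Qed.

(** * Unexpandable polygons in equilibrium are convex *)

Definition adj (N : nat) (i j : 'Z_N.+4) : bool := (j == i + 1) || (i == j + 1).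

Definition diag (N : nat) (i j : 'Z_N.+4) : bool := (i != j) && ~~ adj i j.

Definition sqdist (R : pzRingType) (T : Type) (x y : T -> R) (i j : T) : R :=
  (x i - x j) ^+ 2 + (y i - y j) ^+ 2.

Definition equilibrium (R : pzRingType) (I : finType) (w : I -> I -> R)
    (x : I -> R) : Prop :=
  forall i, \sum_j w i j * (x i - x j) = 0.

(** In tensegrity terms the sides are bars, with stress of either sign, and the diagonals are
    struts. *)
Definition strut_stress (R : numDomainType) (N : nat)
    (w : 'Z_N.+4 -> 'Z_N.+4 -> R) : Prop :=
  (forall i j, w i j = w j i) /\ (forall i j, diag i j -> w i j < 0).

(** A global condition: [x'] and [y'] may be far from [x] and [y]. This makes it applicable to
    reflections, about which equilibrium, being infinitesimal, says nothing. *)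
Definition unexpandable (R : numDomainType) (N : nat) (x y : 'Z_N.+4 -> R) : Prop :=
  forall x' y' : 'Z_N.+4 -> R,
    (forall i, sqdist x' y' i (i + 1) = sqdist x y i (i + 1)) ->
    (forall i j, diag i j -> sqdist x y i j <= sqdist x' y' i j) ->
    forall i j, diag i j -> sqdist x' y' i j <= sqdist x y i j.

Lemma val_succ (N : nat) (i : 'Z_N.+4) :
  val (i + 1) = if val i == N.+3 then 0%N else (val i).+1.
Proof.
case: i => i ltiN; have {}ltiN' : (i < N.+4)%N := ltiN; rewrite /= modnDmr.
case: eqVneq => [->|]; first by rewrite addn1 modnn.
by move=> neq; rewrite addn1 modn_small// ltn_neqAle ltiN' andbT eqSS.
Qed.

Lemma adjC (N : nat) (i j : 'Z_N.+4) : adj i j = adj j i.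
Proof. by rewrite /adj orbC. Qed.

Lemma diagC (N : nat) (i j : 'Z_N.+4) : diag i j = diag j i.
Proof. by rewrite /diag eq_sym adjC. Qed.

Lemma sqdistC (R : comPzRingType) (T : Type) (x y : T -> R) i j :
  sqdist x y i j = sqdist x y j i.
Proof. by rewrite /sqdist; ring. Qed.

(** If both neighbours of [i] were zeros of [f], only diagonals would contribute to the balance of
    forces at [i]. These contributions all have the same sign, so each vanishes, against
    [f k != 0]. *)
Lemma face_neighbour (R : realFieldType) (N : nat) (w : 'Z_N.+4 -> 'Z_N.+4 -> R)
    (f : 'Z_N.+4 -> R) (i k : 'Z_N.+4) :
  strut_stress w -> equilibrium w f -> (forall j, 0 <= f j) -> f k != 0 ->
  f i = 0 -> (f (i + 1) != 0) || (f (i - 1) != 0).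
Proof.
move=> [ws wd] eqf f0 fk fi; apply: contraNT fk.
rewrite negb_or !negbK => /andP[/eqP fp /eqP fm].
have ge0 j : 0 <= - (w i j * f j).
  case: (boolP (diag i j)) => [dij|].
    by rewrite -mulNr mulr_ge0// oppr_ge0 ltW ?wd.
  rewrite negb_and negbK negbK /adj => /or3P[/eqP<-|/eqP->|/eqP ij].
  - by rewrite fi mulr0 oppr0.
  - by rewrite fp mulr0 oppr0.
  - by rewrite -[j](addrK 1) -ij fm mulr0 oppr0.
have S : \sum_j - (w i j * f j) = 0.
  by rewrite -[RHS](eqf i); apply: eq_bigr => j _; rewrite fi sub0r mulrN.
have /(_ k) := psumr_eq0P (fun j _ => ge0 j) S.
move=> /(_ isT) /eqP; rewrite oppr_eq0 mulf_eq0 => /orP[|//] wik.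
have [dik|ndik] := boolP (diag i k); last first.
  move: ndik; rewrite negb_and negbK negbK /adj => /or3P[/eqP<-|/eqP->|/eqP ij].
  - by rewrite fi.
  - by rewrite fp.
  - by rewrite -[k](addrK 1) -ij fm.
by move: (wd _ _ dik); rewrite (eqP wik) ltxx.
Qed.

Lemma equilibrium_affine (R : comPzRingType) (I : finType) (w : I -> I -> R)
    (x y : I -> R) (a b c : R) :
  equilibrium w x -> equilibrium w y -> equilibrium w (fun i => a * x i + b * y i - c).
Proof.
move=> ex ey i.
transitivity (a * (\sum_j w i j * (x i - x j)) + b * (\sum_j w i j * (y i - y j))).
  by rewrite !mulr_sumr -big_split /=; apply: eq_bigr => j _; ring.
by rewrite ex ey !mulr0 addr0.
Qed.

(* If an arc between two points of a supporting line and its complement both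
   leave that line, reflecting the arc expands the polygon. *)
Lemma face_adj (R : realFieldType) (N : nat) (w : 'Z_N.+4 -> 'Z_N.+4 -> R)
    (x y : 'Z_N.+4 -> R) (a b c : R) (i j k : 'Z_N.+4) :
  let f l := a * x l + b * y l - c in
  strut_stress w -> equilibrium w x -> equilibrium w y -> unexpandable x y ->
  (forall l, 0 <= f l) -> f k != 0 -> f i = 0 -> f j = 0 -> i != j -> adj i j.
Proof.
move=> f ws ex ey unexp f0 fk fi fj neij.
have ef : equilibrium w f by exact: equilibrium_affine.
have nb l := face_neighbour ws ef f0 fk (i := l).
apply/negPn/negP => nadj.
have [nij nji] : j != i + 1 /\ i != j + 1 by move: nadj; rewrite negb_or => /andP.
have q0 : 0 < a ^+ 2 + b ^+ 2.
  rewrite lt0r addr_ge0 ?sqr_ge0// andbT; apply: contraNneq fk => /eqP.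
  rewrite paddr_eq0 ?sqr_ge0// !sqrf_eq0 => /andP[/eqP a0 /eqP b0].
  by move: fi; rewrite /f a0 b0 !mul0r => ->.
(* [A] is the arc from [i], included, to [j], excluded. *)
pose s := val (j - i); pose A (l : 'Z_N.+4) := (val (l - i)%R < s)%N.
have shift (l : 'Z_N.+4) : val (l + 1 - i) = if val (l - i) == N.+3 then 0%N else (val (l - i)).+1.
  by rewrite addrAC val_succ.
have vii : val (i - i) = 0%N by rewrite subrr.
have vinj (l m : 'Z_N.+4) : val (l - i) = val (m - i) -> l = m.
  by move=> /val_inj /(congr1 (+%R^~ i)); rewrite !subrK.
have vlt (l : 'Z_N.+4) : (val (l - i)%R < N.+4)%N by exact: ltn_ord.
have s0 : (0 < s)%N.
  by rewrite lt0n; apply: contraNneq neij => h; apply/eqP/vinj; rewrite vii.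
have s1 : (1 < s)%N.
  rewrite ltn_neqAle s0 andbT; apply: contraNneq nij => h; apply/eqP/vinj.
  by rewrite shift vii -[RHS]/(1%N).
have sN : (s < N.+3)%N.
  rewrite ltn_neqAle -ltnS vlt andbT; apply: contraNneq nji => h; apply/eqP/vinj.
  by rewrite shift -/s h eqxx vii.
(* By [face_neighbour], of the two vertices following [i] at least one is off the line; the same
   argument at [j] gives [q] on the other arc. *)
have [p pA fp] : exists2 p, A p & f p != 0.
  case: (eqVneq (f (i + 1)) 0) => [fi1|]; last first.
    by exists (i + 1) => //; rewrite /A shift vii.
  have /orP[h|] := nb _ fi1; last by rewrite addrK fi eqxx.
  exists (i + 1 + 1) => //; rewrite /A !shift vii /=.
  rewrite ltn_neqAle s1 andbT; apply: contraNneq h => h.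
  by rewrite (_ : i + 1 + 1 = j) ?fj//; apply: vinj; rewrite !shift vii -/s -h.
have [q qA fq] : exists2 q, ~~ A q & f q != 0.
  case: (eqVneq (f (j + 1)) 0) => [fj1|]; last first.
    exists (j + 1) => //; rewrite /A shift -/s ltn_eqF//= -leqNgt; lia.
  have /orP[h|] := nb _ fj1; last by rewrite addrK fj eqxx.
  exists (j + 1 + 1) => //; rewrite /A !shift -/s (ltn_eqF sN) /=.
  case: eqVneq => [h'|_]; last by rewrite -leqNgt; lia.
  case/eqP: h; rewrite -fi; congr f; apply: vinj.
  by rewrite !shift -/s (ltn_eqF sN) h' eqxx vii.
(* The arc [A] is reflected in the line [f = 0]. *)
pose X l := if A l then x l - 2 * f l * a / (a ^+ 2 + b ^+ 2) else x l.
pose Y l := if A l then y l - 2 * f l * b / (a ^+ 2 + b ^+ 2) else y l.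
have refl l m : sqdist X Y l m = sqdist x y l m
    + (A l (+) A m)%:R * (4 * f l * f m / (a ^+ 2 + b ^+ 2)).
  rewrite /sqdist /X /Y /f; move: q0; case: (A l); case: (A m) => /= q0; field;
  exact: lt0r_neq0.
(* A side joining the two arcs has an endpoint, [i] or [j], on the mirror line. *)
have side l : sqdist X Y l (l + 1) = sqdist x y l (l + 1).
  rewrite refl; suff : A l (+) A (l + 1) -> f l * f (l + 1) = 0.
    case: (_ (+) _) => [/(_ isT) h|_]; last by rewrite mul0r addr0.
    by rewrite -(mulrA 4) h mulr0 mul0r mulr0 addr0.
  rewrite /A shift.
  case: (eqVneq (val (l - i)) N.+3) => [h|h] hA.
    suff -> : l + 1 = i by rewrite fi mulr0.
    by apply: vinj; rewrite shift h eqxx vii.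
  suff -> : l + 1 = j by rewrite fj mulr0.
  apply: vinj; rewrite shift (negbTE h) -/s; move: hA; lia.
have grow l m : sqdist x y l m <= sqdist X Y l m.
  by rewrite refl lerDl mulr_ge0// divr_ge0 ?(ltW q0)// !mulr_ge0.
(* The reflection preserves the sides but strictly increases the distance from [p] to [q]. *)
have dpq : diag p q.
  have npq : A p (+) A q by rewrite pA (negbTE qA).
  have H : 0 < (A p (+) A q)%:R * (4 * f p * f q / (a ^+ 2 + b ^+ 2)).
    by rewrite npq mul1r divr_gt0// !mulr_gt0// lt0r ?fp ?fq ?f0.
  rewrite /diag /adj; apply/andP; split.
    by apply: contraTneq npq => ->; rewrite addbb.
  rewrite negb_or; apply/andP; split; apply: contraTneq H => h.
    by rewrite -leNgt h -(lerD2l (sqdist x y p (p + 1))) addr0 -refl side.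
  by rewrite -leNgt h -(lerD2l (sqdist x y (q + 1) q)) addr0 -refl
    sqdistC side sqdistC.
have := unexp X Y side (fun l m _ => grow l m) _ _ dpq.
rewrite refl pA (negbTE qA) mul1r gerDl leNgt; apply/negP; rewrite negbK.
by rewrite divr_gt0// !mulr_gt0// lt0r ?fp ?fq ?f0.
Qed.

(** Summation by parts. It shows that an equilibrium stress does no work along any motion [u], and
    with indicator functions for [u] it recovers equilibrium from vanishing work. *)
Lemma work_sum (R : comPzRingType) (I : finType) (w : I -> I -> R) (x u : I -> R) :
  (forall i j, w i j = w j i) ->
  \sum_i \sum_j w i j * ((x i - x j) * (u i - u j))
    = 2 * \sum_i u i * \sum_j w i j * (x i - x j).
Proof.
move=> ws.
have E : \sum_i u i * \sum_j w i j * (x i - x j)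
       = \sum_i \sum_j w i j * ((x i - x j) * u i).
  by apply: eq_bigr => i _; rewrite mulr_sumr; apply: eq_bigr => j _; ring.
have F : \sum_i \sum_j w i j * ((x i - x j) * u i)
       = \sum_i \sum_j - (w i j * ((x i - x j) * u j)).
  rewrite exchange_big /=; apply: eq_bigr => i _; apply: eq_bigr => j _.
  by rewrite ws; ring.
rewrite mulr_natl mulr2n {2}E F E -big_split /=; apply: eq_bigr => i _.
by rewrite -big_split /=; apply: eq_bigr => j _; ring.
Qed.

(** * Gift wrapping of the polygon *)

Lemma adj_triangle_free (N : nat) (i j k : 'Z_N.+4) :
  adj i j -> adj i k -> ~~ adj j k.
Proof.
have vE (a b : 'Z_N.+4) : (a == b) = (val a == val b) by [].
have lt (a : 'Z_N.+4) : (val a < N.+4)%N by exact: ltn_ord.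
rewrite /adj !vE !val_succ; move: (lt i) (lt j) (lt k).
move: (val i) (val j) (val k) => a b c.
by do 3!case: ifP => ?; lia.
Qed.

Definition supporting_edge (R : numDomainType) (N : nat) (x y : 'Z_N.+4 -> R)
    (i j : 'Z_N.+4) : Prop :=
  adj i j /\ forall l, l != i -> l != j -> 0 < orient x y i j l.

(** By [face_adj] the vertices on a supporting line are pairwise adjacent, and a cycle of length at
    least four has no triangle, so [i] and [j] are the only ones. *)
Lemma supporting_edgeP (R : realFieldType) (N : nat) (w : 'Z_N.+4 -> 'Z_N.+4 -> R)
    (x y : 'Z_N.+4 -> R) (i j k : 'Z_N.+4) :
  strut_stress w -> equilibrium w x -> equilibrium w y -> unexpandable x y ->
  i != j -> (forall l, 0 <= orient x y i j l) -> orient x y i j k != 0 ->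
  supporting_edge x y i j.
Proof.
move=> ws ex ey unexp neij ge0 nz.
pose a := y i - y j; pose b := x j - x i; pose c := a * x i + b * y i.
have fE l : a * x l + b * y l - c = orient x y i j l.
  by rewrite /orient /c /a /b; ring.
have face p q : orient x y i j p = 0 -> orient x y i j q = 0 -> p != q -> adj p q.
  by move=> op oq; apply: (@face_adj _ _ w x y a b c p q k ws ex ey unexp) => [l|||];
    rewrite fE.
have oi : orient x y i j i = 0 by rewrite /orient; ring.
have oj : orient x y i j j = 0 by rewrite /orient; ring.
split=> [|l li lj]; first exact: face.
rewrite lt0r ge0 andbT; apply/negP => /eqP ol.
by have := adj_triangle_free (face _ _ ol oi li) (face _ _ ol oj lj); rewrite face.
Qed.

(** The next hull vertex after [j] is the one requiring the least left turn from the direction of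
    [i j]. The quotient [r] is the cotangent of that turn, so it is maximized. *)
Lemma wrap_step (R : realFieldType) (N : nat) (w : 'Z_N.+4 -> 'Z_N.+4 -> R)
    (x y : 'Z_N.+4 -> R) (i j : 'Z_N.+4) :
  strut_stress w -> equilibrium w x -> equilibrium w y -> unexpandable x y ->
  supporting_edge x y i j -> exists2 k, k != i & supporting_edge x y j k.
Proof.
move=> ws ex ey unexp [aij pos].
have adj_neq (p q : 'Z_N.+4) : adj p q -> p != q.
  by move=> h; apply/eqP => pq; subst q; have := adj_triangle_free h h; rewrite h.
have neij := adj_neq _ _ aij.
pose P l := (l != i) && (l != j).
have [l0 Pl0] : exists l0, P l0.
  case: (pickP P) => [l|h]; first by exists l.
  have := h 0; have := h 1; have := h (1 + 1); rewrite /P.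
  have vE (p q : 'Z_N.+4) : (p == q) = (val p == val q) by [].
  have v0 : val (0 : 'Z_N.+4) = 0%N by [].
  have v1 : val (1 : 'Z_N.+4) = 1%N by [].
  have v2 : val (1 + 1 : 'Z_N.+4) = 2%N by [].
  rewrite !vE v0 v1 v2; case: (val i) (val j) => [|[|[|p]]] [|[|[|q]]] //.
pose e l := (x l - x j) * (x j - x i) + (y l - y j) * (y j - y i).
pose r l := e l / orient x y i j l.
case: (arg_maxP r Pl0) => k /andP[ki kj] rmax.
exists k => //.
have ok : 0 < orient x y i j k by exact: pos.
have oki : orient x y j k i = orient x y i j k by rewrite /orient; ring.
apply: (supporting_edgeP (k := i) ws ex ey unexp); first by rewrite eq_sym.
  move=> l.
  have [->|li] := eqVneq l i; first by rewrite oki ltW.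
  have [->|lj] := eqVneq l j; first by rewrite (_ : orient _ _ _ _ _ = 0)// /orient; ring.
  have ol := pos _ li lj.
  have := rmax l; rewrite /P li lj /r => /(_ isT).
  rewrite /= ler_pdivlMr// mulrAC ler_pdivrMr// => H.
  have q0 : 0 < (x j - x i) ^+ 2 + (y j - y i) ^+ 2.
    rewrite lt0r addr_ge0 ?sqr_ge0// andbT; apply: contraTneq ok => /eqP.
    rewrite paddr_eq0 ?sqr_ge0// !sqrf_eq0 => /andP[/eqP a0 /eqP b0].
    by rewrite /orient a0 b0 mul0r mulr0 subrr ltxx.
  rewrite -(pmulr_rge0 _ q0).
  have -> : ((x j - x i) ^+ 2 + (y j - y i) ^+ 2) * orient x y j k l
     = e k * orient x y i j l - e l * orient x y i j k.
    by rewrite /orient /e; ring.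
  by rewrite subr_ge0.
by rewrite oki gt_eqF.
Qed.

Definition noncollinear (R : pzRingType) (T : Type) (x y : T -> R) : Prop :=
  forall a b c, (forall l, a * x l + b * y l = c) -> a = 0 /\ b = 0.

(** Wrapping starts at the rightmost of the lowest vertices; the second vertex has the least angle
    with the horizontal, that is, the greatest cotangent [r], among those strictly higher. *)
Lemma wrap_start (R : realFieldType) (N : nat) (w : 'Z_N.+4 -> 'Z_N.+4 -> R)
    (x y : 'Z_N.+4 -> R) :
  strut_stress w -> equilibrium w x -> equilibrium w y -> unexpandable x y ->
  noncollinear x y -> exists i j, supporting_edge x y i j.
Proof.
move=> ws ex ey unexp nc.
case: (@arg_minP _ _ _ (0 : 'Z_N.+4) predT y isT) => i0 _ ymin.
case: (@arg_maxP _ _ _ i0 (fun l => y l == y i0) x (eqxx _)) => i /eqP yi xmax.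
have {}ymin l : y i <= y l by rewrite yi; apply: ymin.
have {}xmax l : y l = y i -> x l <= x i by rewrite yi => /eqP; apply: xmax.
have [l0 yl0] : exists l0, y l0 != y i.
  case: (pickP (fun l => y l != y i)) => [l|h]; first by exists l.
  have [|_ /eqP] := nc 0 1 (y i); last by rewrite oner_eq0.
  by move=> l; rewrite mul0r add0r mul1r; have /negbFE/eqP := h l.
pose r l := (x l - x i) / (y l - y i).
case: (@arg_maxP _ _ _ l0 (fun l => y l != y i) r yl0) => j yj rmax.
have yij : 0 < y j - y i by rewrite subr_gt0 lt_neqAle eq_sym yj ymin.
exists i, j.
have [k hk] : exists k, orient x y i j k != 0.
  case: (pickP (fun l => orient x y i j l != 0)) => [l|h]; first by exists l.
  have [|/eqP] := nc (y i - y j) (x j - x i) ((y i - y j) * x i + (x j - x i) * y i).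
    move=> l; have /negbFE/eqP := h l; rewrite /orient => hl.
    by apply/eqP; rewrite -subr_eq0 -hl; apply/eqP; ring.
  by rewrite subr_eq0 eq_sym (negbTE yj).
apply: (supporting_edgeP (k := k) ws ex ey unexp) => //.
  by apply: contraNneq yj => ->.
move=> l; rewrite /orient; have [yl|yl] := eqVneq (y l) (y i).
  rewrite yl subrr mulr0 sub0r -mulNr mulr_ge0 ?(ltW yij)//.
  by rewrite oppr_ge0 subr_le0 xmax.
have yil : 0 < y l - y i by rewrite subr_gt0 lt_neqAle eq_sym yl ymin.
have := rmax l yl; rewrite /r /= ler_pdivlMr// mulrAC ler_pdivrMr//.
by rewrite subr_ge0.
Qed.

(** Every supporting edge is a side, so wrapping moves to a cyclic neighbour. It never turns back,
    so it keeps one direction [e] and visits the vertices in cyclic order. *)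
Lemma wrap (R : realFieldType) (N : nat) (w : 'Z_N.+4 -> 'Z_N.+4 -> R)
    (x y : 'Z_N.+4 -> R) :
  strut_stress w -> equilibrium w x -> equilibrium w y -> unexpandable x y ->
  noncollinear x y ->
  exists i e : 'Z_N.+4, (e = 1 \/ e = -1) /\
    forall m, supporting_edge x y (i + e *+ m) (i + e *+ m.+1).
Proof.
move=> ws ex ey unexp nc.
have [i [j ij]] := wrap_start ws ex ey unexp nc.
have [e [e1 je]] : exists e : 'Z_N.+4, (e = 1 \/ e = -1) /\ j = i + e.
  case: (ij) => /orP[/eqP|/eqP] h _; first by exists 1; split; [left|].
  by exists (- 1); split; [right | rewrite h addrK].
exists i, e; split=> //; elim=> [|m IH]; first by rewrite mulr0n addr0 mulr1n -je.
have [k ki hk] := wrap_step ws ex ey unexp IH.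
suff <- : k = i + e *+ m.+2 by [].
have E : i + e *+ m.+2 = i + e *+ m.+1 + e by rewrite -addrA -mulrSr.
have E' : i + e *+ m = i + e *+ m.+1 - e by rewrite mulrSr addrA addrK.
case: hk => /orP[/eqP h|/eqP h] _; case: e1 => e1 {je}.
- by rewrite E h e1.
- by case/eqP: ki; rewrite h E' e1 opprK.
- by case/eqP: ki; rewrite E' h e1 addrK.
- by rewrite E h e1 addrK.
Qed.

Lemma planar_stress_ge0 (R : realFieldType) (N : nat) (w : 'Z_N.+4 -> 'Z_N.+4 -> R)
    (x y : 'Z_N.+4 -> R) (D : 'Z_N.+4 -> 'Z_N.+4 -> R) :
  (forall i j, D i j = D j i) -> (forall i, D i i = 0) -> quad_ineq D ->
  strut_stress w -> equilibrium w x -> equilibrium w y -> unexpandable x y ->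
  noncollinear x y -> 0 <= \sum_i \sum_j w i j * D i j.
Proof.
move=> Ds D0 Dq ws ex ey unexp nc.
have [i0 [e [e1 edge]]] := wrap ws ex ey unexp nc.
(* [s] numbers the vertices counterclockwise from [i0], and [t] is its inverse. *)
pose s m : 'Z_N.+4 := i0 + e *+ m.
have ee : e * e = 1 by case: e1 => ->; rewrite ?mulrNN mulr1.
pose t (i : 'Z_N.+4) : nat := val (e * (i - i0)).
have tK i : s (t i) = i.
  by rewrite /s /t -mulr_natr natr_Zp mulrA ee mul1r addrC subrK.
have tlt i : (t i < N.+4)%N by exact: ltn_ord.
have sK m : (m < N.+4)%N -> t (s m) = m.
  move=> mN; rewrite /t /s addrAC subrr add0r -mulr_natr mulrA ee mul1r.
  by rewrite Zp_nat /= modn_small.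
have sinj m p : (m < N.+4)%N -> (p < N.+4)%N -> m != p -> s m != s p.
  by move=> mN pN; apply: contra_neq => h; rewrite -(sK m)// -(sK p)// h.
have {}edge m l : l != s m -> l != s m.+1 -> 0 < orient x y (s m) (s m.+1) l.
  by case: (edge m) => _; apply.
pose X m := x (s m); pose Y m := y (s m).
have side m l : (m < N.+3)%N -> (l < N.+4)%N -> l != m -> l != m.+1 ->
    0 < orient X Y m m.+1 l.
  by move=> mN lN lm lm1; apply: edge; apply: sinj; rewrite //; lia.
have rot a b c : orient X Y a b c = orient X Y b c a by rewrite /orient; ring.
have [||||||u [v uv]] := @convex_flex R X Y (fun a b => D (s a) (s b)) N.+3.
- by move=> a b; exact: Ds.
- by move=> a b c d; exact: Dq.
- by [].
- have := side 0%N 2%N isT isT isT isT; apply: contraTT.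
  rewrite negb_or !negbK => /andP[/eqP h1 /eqP h2].
  by rewrite /orient -h1 -h2 !subrr mul0r mulr0 subrr ltxx.
- apply: orient_fan => k kN; first by apply: side; lia.
  by rewrite rot; apply: side; lia.
- by move=> a b ab; rewrite rot; apply: side; lia.
pose E a b := (X a - X b) * (u a - u b) + (Y a - Y b) * (v a - v b).
have EC a b : E a b = E b a by rewrite /E; ring.
have work : \sum_i \sum_j w i j * E (t i) (t j) = 0.
  have ws' := ws.1.
  have wx := work_sum x (u \o t) ws'; have wy := work_sum y (v \o t) ws'.
  rewrite [RHS](_ : 0 = 2 * (\sum_i (u \o t) i * \sum_j w i j * (x i - x j))
     + 2 * (\sum_i (v \o t) i * \sum_j w i j * (y i - y j))); last first.
    rewrite !big1 ?mulr0 ?addr0// => i _; first by rewrite ey mulr0.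
    by rewrite ex mulr0.
  rewrite -wx -wy -big_split /=; apply: eq_bigr => i _.
  rewrite -big_split /=; apply: eq_bigr => j _.
  by rewrite /E /X /Y !tK; ring.
(* The motion is exact on sides; on diagonals it is at least as fast as [D], and the negative stress
   reverses the inequality. *)
have key a b : (a < b <= N.+3)%N -> w (s a) (s b) * E a b <= w (s a) (s b) * D (s a) (s b).
  move=> ab; have [le eq] := uv a b ab.
  have [/eq ->//|nside] := boolP ((b == a.+1) || (a == 0%N) && (b == N.+3)).
  have dg : diag (s a) (s b); last by rewrite ler_nM2l// ws.2.
  have neq : s a != s b by apply: sinj; lia.
  rewrite /diag neq /=.
  have Sn m : s m.+1 = s m + e by rewrite /s mulrSr addrA.
  have n1 : s b != s a.+1 by apply: sinj; lia.
  have n2 : s a != s b.+1.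
    have [bN|bN] := eqVneq b N.+3; last by apply: sinj; lia.
    have -> : s b.+1 = s 0%N.
      by rewrite /s mulr0n bN -mulr_natr -Zp_nat_mod // modnn mulr0.
    by apply: sinj; lia.
  rewrite /adj negb_or; move: n1 n2; rewrite !Sn.
  case: e1 => -> n1 n2; rewrite ?n1 ?n2//.
  apply/andP; split; first by apply: contra_neq n2 => ->; rewrite addrK.
  by apply: contra_neq n1 => ->; rewrite addrK.
rewrite -[leLHS]work; apply: ler_sum => i _; apply: ler_sum => j _.
case: (ltngtP (t i) (t j)) => ij.
- by have := key _ _ (introT andP (conj ij (tlt j : (t j <= N.+3)%N))); rewrite !tK.
- have := key _ _ (introT andP (conj ij (tlt i : (t i <= N.+3)%N))); rewrite !tK.
  by rewrite EC Ds ws.1.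
- have -> : i = j by rewrite -(tK i) ij tK.
  by rewrite D0 /E !subrr !mul0r addr0.
Qed.

(** * Semidefinite stresses *)

Definition energy (R : pzRingType) (I : finType) (w : I -> I -> R) (v : I -> R) : R :=
  \sum_i \sum_j w i j * (v i - v j) ^+ 2.

Definition psd_stress (R : numDomainType) (I : finType) (w : I -> I -> R) : Prop :=
  forall v, 0 <= energy w v.

Lemma energy_kernel (R : comPzRingType) (I : finType) (w : I -> I -> R) (x : I -> R) :
  (forall i j, w i j = w j i) -> equilibrium w x -> energy w x = 0.
Proof.
move=> ws ex; rewrite /energy -[RHS](mulr0 2) -[X in _ = 2 * X](_ : \sum_i x i * \sum_j w i j * (x i - x j) = 0).
  by rewrite -work_sum//; do 2!apply: eq_bigr => ? _; rewrite expr2.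
by rewrite big1// => i _; rewrite ex mulr0.
Qed.

(** The given polygon has energy zero, the minimum. An expansion changes no side term and lowers
    every diagonal term weakly, so by semidefiniteness no term changes. *)
Lemma psd_unexpandable (R : realFieldType) (N : nat) (w : 'Z_N.+4 -> 'Z_N.+4 -> R)
    (x y : 'Z_N.+4 -> R) :
  strut_stress w -> psd_stress w -> equilibrium w x -> equilibrium w y ->
  unexpandable x y.
Proof.
move=> [ws wd] psd ex ey x' y' side grow i j dij.
pose T k l := w k l * (sqdist x y k l - sqdist x' y' k l).
have T0 k l : 0 <= T k l.
  rewrite /T; have [dkl|] := boolP (diag k l).
    by rewrite mulr_le0 ?subr_le0 ?grow// ltW ?wd.
  rewrite negb_and negbK negbK /adj => /or3P[/eqP<-|/eqP->|/eqP->].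
  - by rewrite /sqdist !subrr mulr0.
  - by rewrite side subrr mulr0.
  - by rewrite ![sqdist _ _ (l + 1) _]sqdistC side subrr mulr0.
have TE : \sum_k \sum_l T k l = - (energy w x' + energy w y').
  transitivity (energy w x + energy w y - (energy w x' + energy w y')); last first.
    by rewrite (energy_kernel ws ex) (energy_kernel ws ey) addr0 sub0r.
  rewrite /energy -!big_split -sumrB; apply: eq_bigr => k _.
  rewrite -!big_split -sumrB; apply: eq_bigr => l _ /=.
  by rewrite /T /sqdist; ring.
have S0 : \sum_k \sum_l T k l = 0.
  apply/eqP; rewrite eq_le sumr_ge0 ?andbT => [|k _]; last by rewrite sumr_ge0.
  by rewrite TE oppr_le0 addr_ge0 ?psd.
have /(_ i isT) Ti := psumr_eq0P (fun k _ => sumr_ge0 _ (fun l _ => T0 k l)) S0.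
have /(_ j isT) /eqP := psumr_eq0P (fun l _ => T0 i l) Ti.
by rewrite mulf_eq0 (lt_eqF (wd _ _ dij)) /= subr_eq0 => /eqP ->.
Qed.

(** When [u] has sum zero, the Laplacian matrix of the stress loses [tau] times the square of the
    form [u]; hence the plus sign. *)
Definition rank_one_update (R : pzRingType) (I : Type) (w : I -> I -> R) (u : I -> R)
    (tau : R) (i j : I) : R :=
  w i j + tau * (u i * u j).

Lemma energy_update (R : comPzRingType) (I : finType) (w : I -> I -> R) (u v : I -> R)
    (tau : R) :
  \sum_i u i = 0 ->
  energy (rank_one_update w u tau) v
    = energy w v - 2 * tau * (\sum_i u i * v i) ^+ 2.
Proof.
move=> u0; have E : \sum_i \sum_j u i * u j * (v i - v j) ^+ 2
    = - (2 * (\sum_i u i * v i) ^+ 2).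
  rewrite -[RHS](_ : (\sum_i u i * v i ^+ 2) * (\sum_j u j)
      + (\sum_i u i) * (\sum_j u j * v j ^+ 2)
      - 2 * ((\sum_i u i * v i) * \sum_j u j * v j) = _); last by rewrite u0; ring.
  rewrite !big_distrl /= mulr_sumr -big_split -sumrB; apply: eq_bigr => i _ /=.
  rewrite !mulr_sumr -big_split -sumrB; apply: eq_bigr => j _ /=; ring.
rewrite -[RHS](_ : energy w v + tau * (\sum_i \sum_j u i * u j * (v i - v j) ^+ 2) = _).
  rewrite /energy mulr_sumr -big_split; apply: eq_bigr => i _ /=.
  rewrite mulr_sumr -big_split; apply: eq_bigr => j _ /=.
  by rewrite /rank_one_update; ring.
by rewrite E; ring.
Qed.

Lemma laplacian_update (R : comPzRingType) (I : finType) (w : I -> I -> R)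
    (u v : I -> R) (tau : R) (i : I) :
  \sum_i u i = 0 ->
  \sum_j rank_one_update w u tau i j * (v i - v j)
    = \sum_j w i j * (v i - v j) - tau * u i * \sum_j u j * v j.
Proof.
move=> u0; rewrite -[RHS](_ : \sum_j w i j * (v i - v j)
   + tau * u i * (v i * (\sum_j u j) - \sum_j u j * v j) = _).
  rewrite mulr_sumr -sumrB mulr_sumr -big_split; apply: eq_bigr => j _ /=.
  by rewrite /rank_one_update; ring.
by rewrite u0; ring.
Qed.

(* The Schur complement removes from a positive semidefinite form the largest
   multiple of a square that keeps it positive semidefinite, and this creates
   a new kernel vector. *)
Lemma psd_new_kernel (R : realFieldType) (n : nat) (w : 'I_n -> 'I_n -> R)
    (u : 'I_n -> R) (k : 'I_n) :
  (forall i j, w i j = w j i) -> psd_stress w -> \sum_i u i = 0 -> u k != 0 ->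
  exists (z : 'I_n -> R) (tau : R), [/\ 0 <= tau, \sum_i u i * z i != 0,
    equilibrium (rank_one_update w u tau) z & psd_stress (rank_one_update w u tau)].
Proof.
move=> ws psd u0 uk.
pose M : 'M[R]_n := \matrix_(i, j) ((i == j)%:R * (\sum_k w i k) - w i j).
have lapE v i : \sum_j M i j * v j = \sum_j w i j * (v i - v j).
  transitivity ((\sum_k w i k) * v i - \sum_j w i j * v j).
    rewrite -[X in X - _](_ : \sum_j (i == j)%:R * (\sum_k w i k) * v j = _).
      by rewrite -sumrB; apply: eq_bigr => j _; rewrite mxE; ring.
    move: (\sum_k w i k) => C.
    rewrite (bigD1 i)//= eqxx mul1r big1 ?addr0// => j /negbTE ij.
    by rewrite eq_sym ij !mul0r.
  by rewrite mulr_suml -sumrB; apply: eq_bigr => j _; ring.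
have Ms i j : M i j = M j i.
  rewrite !mxE eq_sym ws; congr (_ - _).
  by case: eqVneq => [->|_]//; rewrite !mul0r.
(* If [u] is not in the row space of the Laplacian matrix [M], some kernel vector already pairs
   nontrivially with [u], and [tau] is 0. Otherwise [u] is the Laplacian of some [z], and [tau] is
   the inverse of the pairing [S] of [u] with [z]. *)
case: (boolP ((\row_i u i) <= M)%MS) => [/submxP[Z ZE]|]; last first.
  rewrite submxE => /matrix0Pn[a [b]]; rewrite mxE => nz.
  exists (fun i => cokermx M i b), 0; split=> //.
  - by move: nz; under eq_bigr do rewrite mxE.
  - move=> i; rewrite laplacian_update// mul0r mul0r subr0 -lapE.
    by have /matrixP/(_ i b) := mulmx_coker M; rewrite !mxE.
  - by move=> v; rewrite energy_update// mulr0 mul0r subr0.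
pose z i := Z 0 i; pose S := \sum_i u i * z i.
have lapz i : \sum_j w i j * (z i - z j) = u i.
  rewrite -lapE; have /matrixP/(_ 0 i) := ZE; rewrite !mxE => ->.
  by apply: eq_bigr => j _; rewrite mulrC Ms.
have comb v s : 0 <= energy w v - 4 * s * (\sum_i u i * v i) + 2 * s ^+ 2 * S.
  have := psd (fun i => v i - s * z i); congr (_ <= _).
  have cross y : \sum_i \sum_j w i j * ((z i - z j) * (y i - y j)) = 2 * \sum_i u i * y i.
    rewrite work_sum//; congr (_ * _); apply: eq_bigr => i _.
    by rewrite lapz mulrC.
  rewrite -[RHS](_ : energy w v - 2 * s * (\sum_i \sum_j w i j * ((z i - z j) * (v i - v j)))
     + s ^+ 2 * (\sum_i \sum_j w i j * ((z i - z j) * (z i - z j))) = _).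
    rewrite /energy !mulr_sumr -sumrB -big_split; apply: eq_bigr => i _ /=.
    rewrite !mulr_sumr -sumrB -big_split; apply: eq_bigr => j _ /=; ring.
  by rewrite !cross /S; ring.
have uu : 0 < \sum_i u i * u i.
  rewrite (bigD1 k)//= ltr_pwDl ?sumr_ge0// => [|i _]; last by rewrite -expr2 sqr_ge0.
  by rewrite -expr2 exprn_even_gt0.
have S0 : 0 < S.
  rewrite lt0r; apply/andP; split.
    apply/eqP => S0.
    (* With [S = 0] the bound [comb] is affine in [s], and this [s] gives it the value -1. *)
    have := comb u ((energy w u + 1) / (4 * \sum_i u i * u i)).
    rewrite S0 mulr0 addr0 (_ : 4 * _ * _ = energy w u + 1); first by lra.
    by field; exact: lt0r_neq0.
  by have := comb (fun=> 0) 1; rewrite /energy !big1 => [|i _|i _];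
    [lra | rewrite mulr0 | rewrite big1// => j _; rewrite subrr expr0n mulr0].
exists z, S^-1; split.
- by rewrite invr_ge0 ltW.
- by rewrite gt_eqF.
- by move=> i; rewrite laplacian_update// lapz -/S; field; exact: lt0r_neq0.
(* The chosen [s] minimizes the quadratic polynomial in [comb]. *)
- move=> v; rewrite energy_update//; have := comb v ((\sum_i u i * v i) / S).
  by congr (_ <= _); field; exact: lt0r_neq0.
Qed.

(** Coefficients of the functional that compares vertex [j] with the point dividing the side from
    [i] to [i + 1] in the ratio [t : 1 - t]. *)
Definition side_vertex_form (R : pzRingType) (N : nat) (i j : 'Z_N.+4) (t : R)
    (k : 'Z_N.+4) : R :=
  (1 - t) * (k == i)%:R + t * (k == i + 1)%:R - (k == j)%:R.

Lemma sum_delta (R : pzRingType) (I : finType) (F : I -> R) (i : I) :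
  \sum_k (k == i)%:R * F k = F i.
Proof.
by rewrite (bigD1 i)//= eqxx mul1r big1 ?addr0// => j /negbTE ->; rewrite mul0r.
Qed.

Lemma sum_side_vertex (R : comPzRingType) (N : nat) (i j : 'Z_N.+4) (t : R)
    (F : 'Z_N.+4 -> R) :
  \sum_k side_vertex_form i j t k * F k = (1 - t) * F i + t * F (i + 1) - F j.
Proof.
transitivity ((1 - t) * (\sum_k (k == i)%:R * F k) + t * (\sum_k (k == i + 1)%:R * F k)
   - \sum_k (k == j)%:R * F k); last by rewrite !sum_delta.
rewrite !mulr_sumr -big_split -sumrB; apply: eq_bigr => k _ /=.
by rewrite /side_vertex_form; ring.
Qed.

Lemma side_vertex_sum0 (R : comPzRingType) (N : nat) (i j : 'Z_N.+4) (t : R) :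
  \sum_k side_vertex_form i j t k = 0.
Proof.
have := sum_side_vertex i j t (fun=> 1); under eq_bigr do rewrite mulr1.
by move=> ->; ring.
Qed.

(** The only negative coefficient is at [j]; the two nonnegative ones sit at adjacent vertices, so
    their product never falls on a diagonal. Hence the update below keeps struts negative. *)
Lemma side_vertex_diag (R : realFieldType) (N : nat) (i j a b : 'Z_N.+4) (t : R) :
  0 <= t <= 1 -> j != i -> j != i + 1 -> diag a b ->
  side_vertex_form i j t a * side_vertex_form i j t b <= 0.
Proof.
move=> /andP[t0 t1] ji ji1 /andP[ab].
rewrite /adj negb_or => /andP[ba ab1].
have t1' : 0 <= 1 - t by rewrite subr_ge0.
have pos k : k != j -> 0 <= side_vertex_form i j t k.
  by rewrite /side_vertex_form => /negbTE ->; rewrite subr0 addr_ge0 ?mulr_ge0.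
have neg : side_vertex_form i j t j = -1.
  by rewrite /side_vertex_form (negbTE ji) (negbTE ji1) eqxx !mulr0 add0r sub0r.
have [aj|aj] := eqVneq a j.
  by rewrite aj neg mulN1r oppr_le0 pos// -aj eq_sym.
have [bj|bj] := eqVneq b j.
  by rewrite bj neg mulrN1 oppr_le0 pos.
suff -> : side_vertex_form i j t a * side_vertex_form i j t b = 0 by [].
rewrite /side_vertex_form (negbTE aj) (negbTE bj).
have z : (1 - t) * false%:R + t * false%:R - false%:R = 0 :> R.
  by rewrite !mulr0 addr0 subr0.
have [ai|ai] := eqVneq a i.
  by rewrite -ai [b == a]eq_sym (negbTE ab) (negbTE ba) z mulr0.
have [ai1|ai1] := eqVneq a (i + 1); last first.
  by rewrite z mul0r.
have [bi|bi] := eqVneq b i; first by rewrite bi ai1 eqxx in ab1.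
by rewrite -ai1 [b == a]eq_sym (negbTE ab) z mulr0.
Qed.

(** This is the inequality for the degenerate quadrilateral [i, j, i + 1, j] with weights
    [1 - t, 1, t, 0]. *)
Lemma side_vertex_quad (R : realFieldType) (N : nat) (D : 'Z_N.+4 -> 'Z_N.+4 -> R)
    (i j : 'Z_N.+4) (t : R) :
  (forall i j, D i j = D j i) -> (forall i, D i i = 0) -> quad_ineq D ->
  0 <= t <= 1 ->
  \sum_k \sum_l side_vertex_form i j t k * side_vertex_form i j t l * D k l <= 0.
Proof.
move=> Ds D0 Dq /andP[t0 t1].
have -> : \sum_k \sum_l side_vertex_form i j t k * side_vertex_form i j t l * D k l
   = \sum_k side_vertex_form i j t k * \sum_l side_vertex_form i j t l * D k l.
  by apply: eq_bigr => k _; rewrite mulr_sumr; apply: eq_bigr => l _; rewrite mulrA.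
rewrite sum_side_vertex !sum_side_vertex !D0 [D j i]Ds [D j (i + 1)]Ds [D (i + 1) i]Ds.
have t1' : 0 <= 1 - t by rewrite subr_ge0.
have t10 : 1 - t + t = 1 + 0 by ring.
have := Dq i j (i + 1) j _ _ _ _ t1' ler01 t0 (lexx 0) t10.
rewrite [D j (i + 1)]Ds; lra.
Qed.

(** One step of the reduction: the pairing with [D] does not increase, kernel vectors annihilated by
    [u] survive, and a new one not annihilated by [u] appears. *)
Lemma stress_pin (R : realFieldType) (N : nat) (D w : 'Z_N.+4 -> 'Z_N.+4 -> R)
    (i j : 'Z_N.+4) (t : R) (u := side_vertex_form i j t) :
  (forall i j, D i j = D j i) -> (forall i, D i i = 0) -> quad_ineq D ->
  strut_stress w -> psd_stress w -> 0 <= t <= 1 -> j != i -> j != i + 1 ->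
  exists (w' : 'Z_N.+4 -> 'Z_N.+4 -> R) (z : 'Z_N.+4 -> R),
    [/\ strut_stress w', psd_stress w', equilibrium w' z, \sum_k u k * z k != 0 &
       (forall x, equilibrium w x -> \sum_k u k * x k = 0 -> equilibrium w' x) /\
       \sum_k \sum_l w' k l * D k l <= \sum_k \sum_l w k l * D k l].
Proof.
move=> Ds D0 Dq [ws wd] psd t01 ji ji1.
have u0 : \sum_k u k = 0 by exact: side_vertex_sum0.
have uj : u j != 0.
  by rewrite /u /side_vertex_form (negbTE ji) (negbTE ji1) eqxx !mulr0 add0r sub0r
    oppr_eq0 oner_eq0.
have [z [tau [tau0 uz ez psd']]] := psd_new_kernel ws psd u0 uj.
exists (rank_one_update w u tau), z; split=> //.
  split=> [k l|k l dkl]; first by rewrite /rank_one_update ws [u k * _]mulrC.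
  by rewrite /rank_one_update ltr_wnDr ?wd// mulr_ge0_le0 ?side_vertex_diag.
split=> [x ex ux k|]; first by rewrite laplacian_update// ux ex mulr0 subr0.
have -> : \sum_k \sum_l rank_one_update w u tau k l * D k l
   = \sum_k \sum_l w k l * D k l + tau * \sum_k \sum_l u k * u l * D k l.
  rewrite mulr_sumr -big_split; apply: eq_bigr => k _ /=.
  rewrite mulr_sumr -big_split; apply: eq_bigr => l _ /=.
  by rewrite /rank_one_update; ring.
by rewrite gerDl mulr_ge0_le0// side_vertex_quad.
Qed.

Lemma between_convex (R : realFieldType) (p q r : R) :
  p <= r <= q \/ q <= r <= p -> exists2 t, 0 <= t <= 1 & (1 - t) * p + t * q - r = 0.
Proof.
have [->|pq] := eqVneq p q.
  by move=> pqr; exists 0; rewrite ?lexx ?ler01//; case: pqr; lra.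
have qp0 : q - p != 0 by rewrite subr_eq0 eq_sym.
move=> pqr; exists ((r - p) / (q - p)); last by field.
case: pqr => /andP[h1 h2].
  have qp : 0 < q - p by rewrite lt0r qp0 subr_ge0 (le_trans h1).
  by rewrite divr_ge0 ?subr_ge0//= ?(le_trans h1)// ler_pdivrMr// mul1r lerD2r.
have qp : 0 < p - q by rewrite subr_gt0 lt_neqAle eq_sym pq (le_trans h1).
have -> : (r - p) / (q - p) = (p - r) / (p - q).
  by rewrite -[r - p]opprB -[q - p]opprB invrN mulrNN.
by rewrite divr_ge0 ?subr_ge0 ?(le_trans h1)//= ler_pdivrMr// mul1r lerD2l lerN2.
Qed.

(* A cyclic sequence of reals cannot be an embedded polygon: at its maximum,
   one of the two adjacent sides contains the far end of the other. *)
Lemma vertex_on_side (R : realFieldType) (N : nat) (z : 'Z_N.+4 -> R) :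
  exists (i j : 'Z_N.+4) (t : R), [/\ 0 <= t <= 1, j != i, j != i + 1 &
    (1 - t) * z i + t * z (i + 1) - z j = 0].
Proof.
case: (@arg_maxP _ _ _ (0 : 'Z_N.+4) predT z isT) => i _ zmax.
have n1 : 1 != 0 :> 'Z_N.+4 by [].
have n2 : 1 + 1 != 0 :> 'Z_N.+4 by [].
have i2 : i + 1 != i - 1 by rewrite -subr_eq0 opprB addrC addrA subrK.
have [le|le] := leP (z (i - 1)) (z (i + 1)).
  have [|t t01 tE] := @between_convex _ (z (i - 1)) (z i) (z (i + 1)).
    by left; rewrite le; exact: zmax.
  exists (i - 1), (i + 1), t; split=> //; first by rewrite subrK -subr_eq0 addrAC subrr add0r.
  by rewrite subrK.
have [|t t01 tE] := @between_convex _ (z i) (z (i + 1)) (z (i - 1)).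
  by right; rewrite (ltW le); exact: zmax.
exists i, (i - 1), t; split=> //; last by rewrite eq_sym.
by rewrite -subr_eq0 addrAC subrr add0r oppr_eq0.
Qed.

(** A first pinning, with an arbitrary choice of side and vertex, produces [z1]. The second uses a
    form vanishing on [z1], so [z1] stays in the kernel and [z2] joins it. The two forms then show
    that [(z1, z2)] is not collinear. *)
Lemma psd_stress_ge0 (R : realFieldType) (N : nat) (D w : 'Z_N.+4 -> 'Z_N.+4 -> R) :
  (forall i j, D i j = D j i) -> (forall i, D i i = 0) -> quad_ineq D ->
  strut_stress w -> psd_stress w -> 0 <= \sum_i \sum_j w i j * D i j.
Proof.
move=> Ds D0 Dq wS psd.
have t0 : 0 <= (0 : R) <= 1 by rewrite lexx ler01.
have [//|//|w1 [z1 [wS1 psd1 ez1 uz1 [_ le1]]]] :=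
  stress_pin (i := 0) (j := 1 + 1) Ds D0 Dq wS psd t0.
have [i [j [t [t01 ji ji1 uz]]]] := vertex_on_side z1.
have [w2 [z2 [wS2 psd2 ez2 uz2 [ker2 le2]]]] := stress_pin Ds D0 Dq wS1 psd1 t01 ji ji1.
have ez12 : equilibrium w2 z1 by apply: ker2 => //; rewrite sum_side_vertex.
apply: le_trans (le_trans le2 le1).
apply: (planar_stress_ge0 Ds D0 Dq wS2 ez12 ez2); first exact: (psd_unexpandable wS2 psd2 ez12 ez2).
have lin u a b c : \sum_k u k = 0 -> (forall l, a * z1 l + b * z2 l = c) ->
    a * (\sum_k u k * z1 k) + b * (\sum_k u k * z2 k) = 0.
  move=> u0 h; transitivity ((\sum_k u k) * c); last by rewrite u0 mul0r.
  rewrite !mulr_sumr -big_split mulr_suml /=.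
  by apply: eq_bigr => k _; rewrite -(h k); ring.
move=> a b c h.
have b0 : b = 0.
  have := lin _ _ _ _ (side_vertex_sum0 i j t) h; rewrite [X in a * X]sum_side_vertex uz.
  by rewrite mulr0 add0r => /eqP; rewrite mulf_eq0 (negbTE uz2) orbF => /eqP.
split=> //; have := lin _ _ _ _ (side_vertex_sum0 0 (1 + 1) 0) h.
by rewrite b0 mul0r addr0 => /eqP; rewrite mulf_eq0 (negbTE uz1) orbF => /eqP.
Qed.

(** * The penalty and its minimizers *)

(** The argument [s] is a squared length. The term [delta / (1 + s)] has no pole for [0 <= s] and
    makes the derivative negative on every diagonal, even a long one. *)
Definition penalty (R : realFieldType) (N : nat) (D : 'Z_N.+4 -> 'Z_N.+4 -> R)
    (delta : R) (i j : 'Z_N.+4) (s : R) : R :=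
  if adj i j then (s - D i j) ^+ 2
  else if diag i j then Num.max 0 (D i j - s) ^+ 2 + delta / (1 + s) else 0.

(** The derivative of [penalty] in [s]. *)
Definition slope (R : realFieldType) (N : nat) (D : 'Z_N.+4 -> 'Z_N.+4 -> R)
    (delta : R) (i j : 'Z_N.+4) (s : R) : R :=
  if adj i j then 2 * (s - D i j)
  else if diag i j then - (2 * Num.max 0 (D i j - s) + delta / (1 + s) ^+ 2) else 0.

Definition total_penalty (R : realFieldType) (N : nat) (D : 'Z_N.+4 -> 'Z_N.+4 -> R)
    (delta : R) (x y : 'Z_N.+4 -> R) : R :=
  \sum_i \sum_j penalty D delta i j (sqdist x y i j).

Lemma sqdist_ge0 (R : realFieldType) (T : Type) (x y : T -> R) i j :
  0 <= sqdist x y i j.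
Proof. by rewrite addr_ge0 ?sqr_ge0. Qed.

Lemma diagNadj (N : nat) (i j : 'Z_N.+4) : diag i j -> adj i j = false.
Proof. by move=> /andP[_ /negbTE]. Qed.

Lemma penalty_ge0 (R : realFieldType) (N : nat) (D : 'Z_N.+4 -> 'Z_N.+4 -> R)
    (delta : R) i j s :
  0 <= delta -> 0 <= s -> 0 <= penalty D delta i j s.
Proof.
move=> d0 s0; rewrite /penalty; case: ifP => _; first exact: sqr_ge0.
by case: ifP => // _; rewrite addr_ge0 ?sqr_ge0// divr_ge0// addr_ge0.
Qed.

Lemma max0_sqr_ub (R : realFieldType) (a b : R) :
  Num.max 0 b ^+ 2 <= Num.max 0 a ^+ 2 + 2 * Num.max 0 a * (b - a) + (b - a) ^+ 2.
Proof.
rewrite -subr_ge0; case: (leP 0 a) => a0; case: (leP 0 b) => b0.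
- by rewrite (_ : _ - _ = 0)//; ring.
- by rewrite (_ : _ - _ = b ^+ 2) ?sqr_ge0//; ring.
- rewrite (_ : _ - _ = a ^+ 2 + 2 * (- a * b)); last by ring.
  by rewrite addr_ge0 ?sqr_ge0// !mulr_ge0// oppr_ge0 ltW.
- by rewrite (_ : _ - _ = (b - a) ^+ 2) ?sqr_ge0//; ring.
Qed.

Lemma inv1p_ub (R : realFieldType) (s s' : R) : 0 <= s -> 0 <= s' ->
  (1 + s')^-1 <= (1 + s)^-1 - (s' - s) / (1 + s) ^+ 2 + (s' - s) ^+ 2.
Proof.
move=> s0 s'0.
have p : 0 < 1 + s by lra.
have p' : 0 < 1 + s' by lra.
rewrite -subr_ge0.
have -> : (1 + s)^-1 - (s' - s) / (1 + s) ^+ 2 + (s' - s) ^+ 2 - (1 + s')^-1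
   = (s' - s) ^+ 2 * (1 - ((1 + s) ^+ 2 * (1 + s'))^-1).
  by field; rewrite !lt0r_neq0.
rewrite mulr_ge0 ?sqr_ge0// subr_ge0 invf_le1 ?mulr_gt0 ?exprn_gt0//.
by rewrite mulr_ege1 ?exprn_ege1//; lra.
Qed.

(** A one-sided Taylor estimate with a global quadratic remainder, which at a minimum does the work
    of differentiation. The constant 2 adds 1 for the square and [delta <= 1] for the reciprocal. *)
Lemma penalty_ub (R : realFieldType) (N : nat) (D : 'Z_N.+4 -> 'Z_N.+4 -> R)
    (delta : R) i j s s' :
  0 <= delta <= 1 -> 0 <= s -> 0 <= s' ->
  penalty D delta i j s'
    <= penalty D delta i j s + slope D delta i j s * (s' - s) + 2 * (s' - s) ^+ 2.
Proof.
move=> /andP[d0 d1] s0 s'0; rewrite /penalty /slope.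
have q0 := sqr_ge0 (s' - s).
case: ifP => _; first by nra.
case: ifP => _; last by rewrite mul0r !add0r mulr_ge0.
have h1 := max0_sqr_ub (D i j - s) (D i j - s').
have h2 := ler_wpM2l d0 (inv1p_ub s0 s'0).
have h3 := ler_wpM2r q0 d1.
by move: (Num.max _ _) (Num.max _ _) h1 => a b; lra.
Qed.

Lemma penalty_decr (R : realFieldType) (N : nat) (D : 'Z_N.+4 -> 'Z_N.+4 -> R)
    (delta : R) i j s s' :
  0 < delta -> diag i j -> 0 <= s -> s < s' ->
  penalty D delta i j s' < penalty D delta i j s.
Proof.
move=> d0 dij s0 ss'; rewrite /penalty diagNadj// dij.
have p : 0 < 1 + s by lra.
apply: ler_ltD; last by rewrite ltr_pM2l// ltf_pV2 ?posrE ?ltrD2l//; lra.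
have m0 (t : R) : 0 <= Num.max 0 t by rewrite le_max lexx.
have le : Num.max 0 (D i j - s') <= Num.max 0 (D i j - s).
  by rewrite ge_max m0 le_max; apply/orP; right; lra.
by rewrite lerXn2r ?nnegrE.
Qed.

Lemma slope_struts (R : realFieldType) (N : nat) (D : 'Z_N.+4 -> 'Z_N.+4 -> R)
    (delta : R) (x y : 'Z_N.+4 -> R) :
  (forall i j, D i j = D j i) -> 0 < delta ->
  strut_stress (fun i j => slope D delta i j (sqdist x y i j)).
Proof.
move=> Ds d0; split=> [i j|i j dij].
  by rewrite /slope adjC diagC Ds sqdistC.
rewrite /slope diagNadj// dij oppr_lt0 ltr_wpDl//.
  by rewrite mulr_ge0// le_max lexx.
by rewrite divr_gt0// exprn_gt0// ltr_wpDr// sqdist_ge0.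
Qed.

Definition penalty_min (R : realFieldType) (N : nat) (D : 'Z_N.+4 -> 'Z_N.+4 -> R)
    (delta : R) (x y : 'Z_N.+4 -> R) : Prop :=
  forall x' y', total_penalty D delta x y <= total_penalty D delta x' y'.

(** Displacement by [e] times [(u, v)] changes squared lengths by a quadratic polynomial in [e], so
    [penalty_ub] gives a quartic one. Its linear term yields equilibrium; when [A] vanishes, its
    quadratic term yields semidefiniteness. *)
Lemma penalty_variation (R : realFieldType) (N : nat) (D : 'Z_N.+4 -> 'Z_N.+4 -> R)
    (delta : R) (x y u v : 'Z_N.+4 -> R) :
  let w i j := slope D delta i j (sqdist x y i j) in
  let A i j := 2 * ((x i - x j) * (u i - u j) + (y i - y j) * (v i - v j)) in
  0 <= delta <= 1 -> penalty_min D delta x y ->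
  exists b c d : R, forall e : R,
    0 <= e * (\sum_i \sum_j w i j * A i j)
       + e ^+ 2 * (\sum_i \sum_j w i j * sqdist u v i j + b) + e ^+ 3 * c + e ^+ 4 * d
    /\ ((forall i j, A i j = 0) -> b = 0 /\ c = 0).
Proof.
move=> w A d01 pmin; pose B i j := sqdist u v i j.
exists (2 * \sum_i \sum_j A i j ^+ 2), (4 * \sum_i \sum_j A i j * B i j).
exists (2 * \sum_i \sum_j B i j ^+ 2) => e; split; last first.
  move=> A0; rewrite !big1 ?mulr0// => i _; apply: big1 => j _; rewrite A0 ?mul0r//.
  by rewrite expr0n.
pose X i := x i + e * u i; pose Y i := y i + e * v i.
have sE i j : sqdist X Y i j - sqdist x y i j = e * A i j + e ^+ 2 * B i j.
  by rewrite /sqdist /X /Y /A /B /sqdist; ring.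
have le : total_penalty D delta X Y <= total_penalty D delta x y
    + \sum_i \sum_j (w i j * (e * A i j + e ^+ 2 * B i j)
                     + 2 * (e * A i j + e ^+ 2 * B i j) ^+ 2).
  rewrite -big_split; apply: ler_sum => i _ /=; rewrite -big_split.
  apply: ler_sum => j _ /=; rewrite -sE addrA.
  by apply: penalty_ub; rewrite ?sqdist_ge0.
have := le_trans (pmin X Y) le; rewrite lerDl; congr (_ <= _).
rewrite mulrDr !addrA !mulr_sumr -!big_split; apply: eq_bigr => i _ /=.
rewrite !mulr_sumr -!big_split; apply: eq_bigr => j _ /=.
by rewrite -/(B i j); ring.
Qed.

Lemma poly4_ge0 (R : realFieldType) (a b c d : R) :
  (forall e, 0 <= e * a + e ^+ 2 * b + e ^+ 3 * c + e ^+ 4 * d) -> a = 0.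
Proof.
(* [M] is so large that at [- a / M] the linear term outweighs the others unless [a = 0]. *)
move=> h; pose M := `|b| + `|c| + `|d| + `|a| + 1.
have M0 : 0 < M by rewrite ltr_wpDl// !addr_ge0.
pose e := a / M.
have e1 : `|e| <= 1.
  rewrite /e normrM normfV (gtr0_norm M0) ler_pdivrMr// mul1r /M.
  by have := normr_ge0 b; have := normr_ge0 c; have := normr_ge0 d; lra.
have e2 := sqr_ge0 e.
have H := h (- e).
have aE : a = e * M by rewrite /e divfK// gt_eqF.
have ea : e * a = e ^+ 2 * M by rewrite [in LHS]aE expr2 mulrA.
have hb := ler_norm b; have hc := ler_norm (- e * c); have hd := ler_norm (e ^+ 2 * d).
have hc' : - e * c <= `|c|.
  by apply: le_trans hc _; rewrite normrM normrN ler_piMl.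
have hd' : e ^+ 2 * d <= `|d|.
  by apply: le_trans hd _; rewrite normrM normrX ler_piMl// expr_le1.
have : e ^+ 2 * (1 + `|a|) <= 0.
  have -> : e ^+ 2 * (1 + `|a|) = e * a - e ^+ 2 * (`|b| + `|c| + `|d|).
    by rewrite ea /M; ring.
  rewrite subr_le0; apply: le_trans (_ : e ^+ 2 * (b + (- e * c) + e ^+ 2 * d) >= e * a) _.
    by move: H; lra.
  by apply: ler_wpM2l => //; lra.
rewrite pmulr_lle0 ?ltr_pwDl// => e20.
have /eqP : e ^+ 2 = 0 by apply/eqP; rewrite eq_le e20 e2.
by rewrite sqrf_eq0 aE => /eqP ->; rewrite mul0r.
Qed.

Lemma poly24_ge0 (R : realFieldType) (b d : R) :
  (forall e, 0 <= e ^+ 2 * b + e ^+ 4 * d) -> 0 <= b.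
Proof.
move=> h; rewrite leNgt; apply/negP => b0.
(* At [- b / M], which lies between 0 and 1, the quartic term cannot compensate a negative [b]. *)
pose M := `|d| - b + 1.
have M0 : 0 < M by have := normr_ge0 d; rewrite /M; lra.
pose e := - b / M.
have e0 : 0 < e by rewrite divr_gt0 ?oppr_gt0.
have e1 : e <= 1.
  by rewrite ler_pdivrMr// mul1r /M; have := normr_ge0 d; lra.
have := h e; rewrite (_ : _ + _ = e ^+ 2 * (b + e ^+ 2 * d)); last by ring.
rewrite pmulr_rge0 ?exprn_gt0//; apply/negP; rewrite -ltNge.
have h1 : e ^+ 2 * d <= e * `|d|.
  rewrite expr2 -mulrA ler_pM2l//; apply: le_trans (ler_norm _) _.
  by rewrite normrM ger0_norm ?(ltW e0)// ler_piMl.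
have h2 : e * `|d| < - b.
  rewrite /e mulrAC ltr_pdivrMr// ltr_pM2l ?oppr_gt0// /M; lra.
lra.
Qed.

Lemma min_equilibrium (R : realFieldType) (N : nat) (D : 'Z_N.+4 -> 'Z_N.+4 -> R)
    (delta : R) (x y : 'Z_N.+4 -> R) :
  let w i j := slope D delta i j (sqdist x y i j) in
  (forall i j, D i j = D j i) -> 0 < delta <= 1 -> penalty_min D delta x y ->
  equilibrium w x /\ equilibrium w y.
Proof.
move=> w Ds /andP[d0 d1] pmin; have [ws _] := slope_struts x y Ds d0.
have d01 : 0 <= delta <= 1 by rewrite ltW.
have crit u v : \sum_k \sum_l w k l * ((x k - x l) * (u k - u l))
    + \sum_k \sum_l w k l * ((y k - y l) * (v k - v l)) = 0.
  have [b [c [d var]]] := penalty_variation u v d01 pmin.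
  have := poly4_ge0 (fun e => (var e).1) => /(congr1 ( *%R 2^-1)).
  rewrite mulr0 => E; rewrite -[RHS]E mulr_sumr -big_split; apply: eq_bigr => k _ /=.
  rewrite mulr_sumr -big_split; apply: eq_bigr => l _ /=.
  by rewrite /w; field.
have null z i : \sum_k \sum_l w k l * ((z k - z l) * ((k == i)%:R - (l == i)%:R)) = 0 ->
    \sum_l w i l * (z i - z l) = 0.
  rewrite (work_sum z (fun k => (k == i)%:R) ws) sum_delta => /eqP.
  by rewrite mulf_eq0 pnatr_eq0 /= => /eqP.
split=> i; apply: null.
- rewrite -[RHS](crit (fun k => (k == i)%:R) (fun=> 0)).
  by rewrite [X in _ = _ + X]big1 ?addr0// => k _; apply: big1 => l _ /=; rewrite subrr !mulr0.
- rewrite -[RHS](crit (fun=> 0) (fun k => (k == i)%:R)).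
  by rewrite [X in _ = X + _]big1 ?add0r// => k _; apply: big1 => l _; rewrite oppr0 !mulr0.
Qed.

(** An expansion leaves the side penalties alone and strictly lowers the penalty of each diagonal
    that grows. *)
Lemma min_unexpandable (R : realFieldType) (N : nat) (D : 'Z_N.+4 -> 'Z_N.+4 -> R)
    (delta : R) (x y : 'Z_N.+4 -> R) :
  0 < delta -> penalty_min D delta x y -> unexpandable x y.
Proof.
move=> d0 pmin x' y' side grow i j dij.
pose T k l := penalty D delta k l (sqdist x y k l) - penalty D delta k l (sqdist x' y' k l).
have T0 k l : 0 <= T k l.
  rewrite subr_ge0; have [dkl|] := boolP (diag k l).
    move: (grow _ _ dkl); rewrite le_eqVlt => /orP[/eqP->//|lt].
    by rewrite ltW// penalty_decr// sqdist_ge0.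
  rewrite negb_and negbK negbK /adj => /or3P[/eqP<-|/eqP->|/eqP->].
  - by rewrite /sqdist !subrr.
  - by rewrite side.
  - by rewrite ![sqdist _ _ (l + 1) _]sqdistC side.
have S0 : \sum_k \sum_l T k l = 0.
  apply/eqP; rewrite eq_le sumr_ge0 ?andbT => [|k _]; last by rewrite sumr_ge0.
  have := pmin x' y'; rewrite -subr_le0; congr (_ <= _).
  by rewrite -sumrB; apply: eq_bigr => k _; rewrite -sumrB.
have /(_ i isT) Ti := psumr_eq0P (fun k _ => sumr_ge0 _ (fun l _ => T0 k l)) S0.
have /(_ j isT) /eqP := psumr_eq0P (fun l _ => T0 i l) Ti.
rewrite subr_eq0 leNgt => /eqP E; apply/negP => lt.
by have := penalty_decr D d0 dij (sqdist_ge0 x y i j) lt; rewrite E ltxx.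
Qed.

(* Only motions orthogonal to the line are available, but they suffice: they do
   not change the distances to first order. *)
Lemma min_collinear_psd (R : realFieldType) (N : nat) (D : 'Z_N.+4 -> 'Z_N.+4 -> R)
    (delta : R) (x y : 'Z_N.+4 -> R) (a b c : R) :
  0 <= delta <= 1 -> penalty_min D delta x y ->
  (forall l, a * x l + b * y l = c) -> (a != 0) || (b != 0) ->
  psd_stress (fun i j => slope D delta i j (sqdist x y i j)).
Proof.
move=> d01 pmin abc ab v.
have q0 : 0 < a ^+ 2 + b ^+ 2.
  by rewrite lt0r addr_ge0 ?sqr_ge0// andbT paddr_eq0 ?sqr_ge0// !sqrf_eq0 negb_and.
have [p [q [r var]]] := penalty_variation (fun i => a * v i) (fun i => b * v i) d01 pmin.
have A0 i j : 2 * ((x i - x j) * (a * v i - a * v j) + (y i - y j) * (b * v i - b * v j)) = 0.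
  transitivity (2 * (v i - v j) * ((a * x i + b * y i) - (a * x j + b * y j))); first by ring.
  by rewrite !abc subrr mulr0.
have [p0 q00] := (var 0).2 A0.
rewrite -(pmulr_rge0 _ q0).
have -> : (a ^+ 2 + b ^+ 2) * energy (fun i j => slope D delta i j (sqdist x y i j)) v
   = \sum_i \sum_j slope D delta i j (sqdist x y i j)
       * sqdist (fun i => a * v i) (fun i => b * v i) i j.
  rewrite /energy mulr_sumr; apply: eq_bigr => i _; rewrite mulr_sumr.
  by apply: eq_bigr => j _; rewrite [in RHS]/sqdist; ring.
apply: (@poly24_ge0 _ _ r) => e; have [h _] := var e; move: h.
rewrite p0 q00 addr0 mulr0 addr0 big1 ?mulr0 ?add0r// => i _.
by apply: big1 => j _; rewrite A0 mulr0.
Qed.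

Lemma penalty_min_ub (R : realFieldType) (N : nat) (D : 'Z_N.+4 -> 'Z_N.+4 -> R)
    (delta : R) (x y : 'Z_N.+4 -> R) :
  (forall i j, D i j = D j i) -> (forall i, D i i = 0) -> (forall i j, 0 <= D i j) ->
  quad_ineq D -> 0 < delta <= 1 -> penalty_min D delta x y ->
  total_penalty D 0 x y <= delta * (N.+4 * N.+4)%:R.
Proof.
move=> Ds D0 Dge0 Dq d01 pmin.
have [ex ey] := min_equilibrium Ds d01 pmin.
case/andP: d01 => d0 d1; have wS := slope_struts x y Ds d0.
set w := fun i j => _ in wS ex ey.
(* Noncollinear minimizers are handled by convexity, collinear ones by semidefiniteness. *)
have LD : 0 <= \sum_i \sum_j w i j * D i j.
  have [nc|] := pselect (noncollinear x y).
    apply: (planar_stress_ge0 Ds D0 Dq wS ex ey _ nc).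
    exact: (min_unexpandable d0 pmin).
  move=> /existsNP[a /existsNP[b /existsNP[c /not_implyP[abc nab]]]].
  apply: (psd_stress_ge0 Ds D0 Dq wS).
  apply: (min_collinear_psd _ pmin abc); first by rewrite ltW.
  by apply/orP; apply: contrapT => h; apply: nab; split; apply/eqP/negPn/negP => h';
    apply: h; [left|right].
have LS : \sum_i \sum_j w i j * sqdist x y i j = 0.
  transitivity (energy w x + energy w y); last first.
    by rewrite (energy_kernel wS.1 ex) (energy_kernel wS.1 ey) addr0.
  rewrite /energy -big_split; apply: eq_bigr => i _ /=.
  by rewrite -big_split; apply: eq_bigr => j _ /=; rewrite -mulrDr.
(* On a side the right-hand side is twice the penalty. On a diagonal it is twice the penalty at
   [delta = 0] minus [delta (s - D) / (1 + s)^2], a loss of at most [delta] because [0 <= D]. *)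
have term i j : penalty D 0 i j (sqdist x y i j) - delta
    <= w i j * (sqdist x y i j - D i j).
  rewrite /w; move: (sqdist x y i j) (sqdist_ge0 x y i j) (Dge0 i j) => s s0 Dij.
  rewrite /penalty /slope; case: ifP => _.
    by have := sqr_ge0 (s - D i j); nra.
  case: ifP => _; last by rewrite mul0r sub0r oppr_le0 ltW.
  rewrite mul0r addr0.
  have h : delta * ((s - D i j) / (1 + s) ^+ 2) <= delta.
    have p : 0 < 1 + s by lra.
    rewrite ler_piMr ?(ltW d0)// ler_pdivrMr ?exprn_gt0// mul1r.
    by have := sqr_ge0 s; lra.
  set m := Num.max 0 _.
  have -> : - (2 * m + delta / (1 + s) ^+ 2) * (s - D i j)
      = 2 * (m * (D i j - s)) - delta * ((s - D i j) / (1 + s) ^+ 2) by ring.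
  have mE : m * (D i j - s) = m ^+ 2.
    by rewrite /m; case: leP => _; rewrite ?mul0r ?expr0n ?expr2.
  by rewrite mE; have := sqr_ge0 m; lra.
have : \sum_i \sum_j (penalty D 0 i j (sqdist x y i j) - delta)
    <= \sum_i \sum_j w i j * (sqdist x y i j - D i j).
  by do 2!(apply: ler_sum => ? _).
have -> : \sum_i \sum_j w i j * (sqdist x y i j - D i j) = - \sum_i \sum_j w i j * D i j.
  rewrite -[RHS]add0r -[X in X - _]LS -sumrB; apply: eq_bigr => i _.
  by rewrite -sumrB; apply: eq_bigr => j _; rewrite mulrBr.
have -> : \sum_i \sum_j (penalty D 0 i j (sqdist x y i j) - delta)
    = total_penalty D 0 x y - delta * (N.+4 * N.+4)%:R.
  rewrite /total_penalty; under eq_bigr do rewrite sumrB.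
  rewrite sumrB; congr (_ - _).
  by rewrite !sumr_const !card_ord -mulrnA mulr_natr.
by lra.
Qed.

(** * Existence of minimizers *)

Lemma continuous_bigsum (T : topologicalType) (R : realType) (I : Type) (r : seq I)
    (F : I -> T -> R) :
  (forall i, continuous (F i)) -> continuous (fun t => \sum_(i <- r) F i t).
Proof.
move=> cF; elim: r => [|i r IH].
  by under eq_fun do rewrite big_nil; move=> t; exact: cvg_cst.
by under eq_fun do rewrite big_cons; move=> t; exact: (continuousD (cF i t) (IH t)).
Qed.

Lemma continuous_penalty (R : realType) (N : nat) (D : 'Z_N.+4 -> 'Z_N.+4 -> R)
    (delta : R) (T : topologicalType) (s : T -> R) i j :
  continuous s -> (forall t, 0 <= s t) ->
  continuous (fun t => penalty D delta i j (s t)).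
Proof.
move=> cs s0 t; rewrite /penalty; case: (adj i j).
  apply: (@continuousM _ _ (fun t => s t - D i j) (fun t => s t - D i j));
  by apply: continuousB; [exact: cs|exact: cvg_cst].
case: (diag i j); last exact: cvg_cst.
have cm : {for t, continuous (fun t => Num.max 0 (D i j - s t))}.
  apply: continuous_max; first exact: cvg_cst.
  by apply: continuousB; [exact: cvg_cst|exact: cs].
apply: cvgD; first exact: (cvgM cm cm).
apply: cvgM; first exact: cvg_cst.
apply: cvgV; first by rewrite gt_eqF// ltr_wpDr.
by apply: cvgD; [exact: cvg_cst|exact: cs].
Qed.

Lemma total_penalty_translate (R : realFieldType) (N : nat)
    (D : 'Z_N.+4 -> 'Z_N.+4 -> R) (delta : R) (x y : 'Z_N.+4 -> R) (a b : R) :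
  total_penalty D delta (fun i => x i - a) (fun i => y i - b) = total_penalty D delta x y.
Proof.
apply: eq_bigr => i _; apply: eq_bigr => j _; congr penalty.
by rewrite /sqdist; ring.
Qed.

Lemma side_le_total (R : realFieldType) (N : nat) (D : 'Z_N.+4 -> 'Z_N.+4 -> R)
    (delta : R) (x y : 'Z_N.+4 -> R) (i : 'Z_N.+4) :
  0 <= delta ->
  (sqdist x y i (i + 1) - D i (i + 1)) ^+ 2 <= total_penalty D delta x y.
Proof.
move=> d0; have P0 k l := penalty_ge0 D k l d0 (sqdist_ge0 x y k l).
rewrite /total_penalty (bigD1 i)//= (bigD1 (i + 1))//=.
rewrite {1}/penalty {1}/adj eqxx /= -!addrA lerDl addr_ge0// sumr_ge0// => k _.
by rewrite sumr_ge0.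
Qed.

Lemma chain_bound (R : realFieldType) (N : nat) (x : 'Z_N.+4 -> R) (C : R) :
  (forall i, `|x i - x (i + 1)| <= C) -> forall i, `|x i - x 0| <= C * N.+4%:R.
Proof.
move=> side i; have C0 : 0 <= C by apply: le_trans (side 0).
have step m : `|x m%:R - x 0| <= C * m%:R.
  elim: m => [|m IH]; first by rewrite subrr normr0 mulr0.
  have -> : C * m.+1%:R = C * m%:R + C by rewrite -natr1 mulrDr mulr1.
  rewrite (mulrSr 1 m) (_ : _ - _ = (x m%:R - x 0) - (x m%:R - x (m%:R + 1))); last by ring.
  by rewrite (le_trans (ler_normB _ _))// lerD.
have := step (val i); rewrite natr_Zp => h; apply: le_trans h _.
by rewrite ler_wpM2l// ler_nat ltnW// ltn_ord.
Qed.

(** Up to translation the penalty is coercive: it bounds the sides, hence the distances to vertex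
    [0]. A minimizer over a large box is therefore a global one. *)
Lemma penalty_min_exists (R : realType) (N : nat) (D : 'Z_N.+4 -> 'Z_N.+4 -> R)
    (delta : R) :
  0 <= delta -> exists x y, penalty_min D delta x y.
Proof.
move=> d0; pose K := total_penalty D delta (fun=> 0) (fun=> 0).
have K0 : 0 <= K.
  by do 2!(apply: sumr_ge0 => ? _); rewrite penalty_ge0 ?sqdist_ge0.
(* When the penalty is at most [K], a squared side exceeds its target by at most [K + 1]. So [C]
   bounds the squared sides and, as [1 <= C], the sides too. *)
pose C := K + 1 + \sum_i `|D i (i + 1)|.
have Dle i : D i (i + 1) <= \sum_i `|D i (i + 1)|.
  by rewrite (bigD1 i)//= (le_trans (ler_norm _))// lerDl sumr_ge0.
have C1 : 1 <= C by rewrite /C -addrA addrCA lerDl addr_ge0// sumr_ge0.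
have bound x y : total_penalty D delta x y <= K -> forall i,
    `|x i - x 0| <= C * N.+4%:R /\ `|y i - y 0| <= C * N.+4%:R.
  move=> le.
  have side i : sqdist x y i (i + 1) <= C ^+ 2.
    have := le_trans (side_le_total D x y i d0) le; have := Dle i.
    move: (sqdist _ _ _ _) => s h1 h2.
    have s1 : s - D i (i + 1) <= K + 1.
      by have := sqr_ge0 (s - D i (i + 1) - 1); move: h2; lra.
    apply: (@le_trans _ _ C); first by rewrite /C; lra.
    by rewrite expr2 ler_peMl// (le_trans ler01).
  have C0 : 0 <= C by apply: le_trans C1.
  move=> i; split; apply: chain_bound => {}i; rewrite -(ler_pXn2r (n := 2)) ?nnegrE//;
  by rewrite -normrX ger0_norm ?sqr_ge0// (le_trans _ (side i))// /sqdist ?lerDl ?lerDr sqr_ge0.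
pose M := C * N.+4%:R.
have M0 : 0 <= M by rewrite mulr_ge0// (le_trans ler01).
pose X (r : 'rV[R]_(N.+4 + N.+4)) (i : 'Z_N.+4) := r ord0 (lshift N.+4 i).
pose Y (r : 'rV[R]_(N.+4 + N.+4)) (i : 'Z_N.+4) := r ord0 (rshift N.+4 i).
pose A := [set r : 'rV[R]_(N.+4 + N.+4) | forall k, `[- M, M]%classic (r ord0 k)]%classic.
pose F r := total_penalty D delta (X r) (Y r).
have cF : continuous F.
  apply: continuous_bigsum => i; apply: continuous_bigsum => j.
  apply: continuous_penalty => [r|r]; last exact: sqdist_ge0.
  have cc k : continuous (fun r : 'rV[R]_(N.+4 + N.+4) => r ord0 k) by exact: coord_continuous.
  have cq k l : {for r, continuous (fun r : 'rV[R]_(N.+4 + N.+4) => (r ord0 k - r ord0 l) ^+ 2)}.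
    have cB : {for r, continuous (fun r : 'rV[R]_(N.+4 + N.+4) => r ord0 k - r ord0 l)}.
      by apply: continuousB; exact: cc.
    exact: (continuousM cB cB).
  exact: (continuousD (cq _ _) (cq _ _)).
have A0 : A 0 by move=> k /=; rewrite in_itv /= mxE oppr_le0 M0.
have cA : compact A by apply: (@rV_compact R _ (fun=> `[- M, M]%classic)) => k; exact: segment_compact.
have [r _ rmin] := EVT_min_rV (ex_intro _ _ A0) cA (continuous_subspaceT cF).
exists (X r), (Y r) => x y.
have FK : F r <= K.
  have -> : K = F 0 by congr total_penalty; apply/funext => i; rewrite /X /Y mxE.
  by apply: rmin; rewrite inE.
(* A polygon of penalty above [K] loses to the constant one; any other lies in the box once vertex
   [0] is translated to the origin. *)
have [le|lt] := leP (total_penalty D delta x y) K; last exact: le_trans FK (ltW lt).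
pose q : 'rV[R]_(N.+4 + N.+4) := row_mx (\row_i (x i - x 0)) (\row_i (y i - y 0)).
have Fq : F q = total_penalty D delta x y.
  rewrite -(total_penalty_translate _ _ x y (x 0) (y 0)).
  by congr total_penalty; apply/funext => i; rewrite /X /Y /q ?row_mxEl ?row_mxEr mxE.
rewrite -Fq; apply: rmin; rewrite inE => k /=.
rewrite in_itv /= -ler_norml /q.
have b := bound _ _ le.
by case: (split_ordP k) => i ->; rewrite ?row_mxEl ?row_mxEr mxE; case: (b i).
Qed.

(** * From the metric inequalities to the comparison polygon *)

Lemma boxtimes_quad_ineq (R : realType) (X : metricType R) (T : Type) (f : T -> X) :
  boxtimes_inequalities X -> quad_ineq (fun i j => mdist (f i) (f j) ^+ 2).
Proof.
move=> box i j k l a b c e a0 b0 c0 e0 abce.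
have [S0|S0] := eqVneq (a + c) 0.
  have a00 : a = 0 by lra.
  have b00 : b = 0 by lra.
  have c00 : c = 0 by lra.
  have e00 : e = 0 by lra.
  by rewrite a00 b00 c00 e00 !mul0r !addr0.
have Sp : 0 < a + c by rewrite lt0r S0 addr_ge0.
have t01 : 0 <= c / (a + c) <= 1.
  by rewrite divr_ge0 ?addr_ge0//= ler_pdivrMr// mul1r lerDr.
have s01 : 0 <= e / (a + c) <= 1.
  by rewrite divr_ge0 ?addr_ge0//= ler_pdivrMr// mul1r abce lerDr.
have := box _ _ (f i) (f j) (f k) (f l) t01 s01.
have -> : 1 - c / (a + c) = a / (a + c) by field.
have -> : 1 - e / (a + c) = b / (a + c) by rewrite (_ : b = a + c - e); [field|lra].
rewrite -(pmulr_rge0 _ (mulr_gt0 Sp Sp)) => H; rewrite -subr_ge0; move: H; congr (_ <= _).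
by field.
Qed.

Theorem corollary1p12 (R : realType) (X : metricType R) :
  boxtimes_inequalities X -> forall n : nat, (4 <= n)%N -> Cycl0 n X.
Proof.
move=> box [|[|[|[|N]]]]// _ f.
pose D (i j : 'Z_N.+4) := mdist (f i) (f j) ^+ 2.
have Ds i j : D i j = D j i by rewrite /D metric_sym.
have D0 i : D i i = 0 by rewrite /D mdistxx expr0n.
have Dge0 i j : 0 <= D i j by exact: sqr_ge0.
have Dq : quad_ineq D by exact: boxtimes_quad_ineq.
(* The polygon sought is a minimizer at [delta = 0]. Its penalty is at most that of the minimizers
   for positive [delta], evaluated at [delta = 0], which is arbitrarily small; no limit of polygons
   is taken. *)
have [x [y pmin]] := penalty_min_exists D (lexx 0).
have P0 i j := penalty_ge0 D i j (lexx 0) (sqdist_ge0 x y i j).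
have total0 : total_penalty D 0 x y = 0.
  apply/eqP; rewrite eq_le sumr_ge0 ?andbT => [|i _]; last by rewrite sumr_ge0.
  pose n2 : R := (N.+4 * N.+4)%:R.
  have n20 : 0 < n2 by rewrite ltr0n.
  apply/ler_addgt0Pl => e e0; rewrite addr0.
  pose d := Num.min 1 (e / n2).
  have d01 : 0 < d <= 1 by rewrite lt_min ltr01 divr_gt0//= ge_min lexx.
  have [x' [y' pmin']] := penalty_min_exists D (ltW (andP d01).1).
  apply: le_trans (pmin x' y') (le_trans (penalty_min_ub Ds D0 Dge0 Dq d01 pmin') _).
  by rewrite -ler_pdivlMr// ge_min lexx orbT.
have term i j : penalty D 0 i j (sqdist x y i j) = 0.
  have /(_ i isT) Ti := psumr_eq0P (fun k _ => sumr_ge0 _ (fun l _ => P0 k l)) total0.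
  by have /(_ j isT) := psumr_eq0P (fun l _ => P0 i l) Ti.
exists (fun i => \row_(k < 2) (if k == 0 then x i else y i)).
have nE i j : euclidean_norm ((\row_(k < 2) (if k == 0 then x i else y i))
    - (\row_(k < 2) (if k == 0 then x j else y j))) = Num.sqrt (sqdist x y i j).
  by rewrite /euclidean_norm !big_ord_recl big_ord0 !mxE addr0.
have mE i j : mdist (f i) (f j) = Num.sqrt (D i j).
  by rewrite sqrtr_sqr ger0_norm// mdist_ge0.
split=> [i|i j /eqP ij /eqP ji]; rewrite nE mE; apply: ler_wsqrtr.
  have := term i (i + 1); rewrite /penalty {1}/adj eqxx => /eqP.
  by rewrite sqrf_eq0 subr_eq0 => /eqP ->.
(* The pairs in the second clause of [Cycl0] include [i = j], which [diag] excludes. *)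
have [->|neq] := eqVneq i j; first by rewrite D0 sqdist_ge0.
have dij : diag i j by rewrite /diag /adj neq (negbTE ij) (negbTE ji).
have := term i j; rewrite /penalty diagNadj// dij mul0r addr0 => /eqP.
by rewrite sqrf_eq0 => /eqP h; rewrite -subr_le0 -h le_max lexx orbT.
Qed.
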